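(* Let $z>0$ and let $(P_n)_{n\ge0}$ be the monic orthogonal polynomials with respect to $\langle \mathbf{u}_z,p\rangle=\int_0^\infty p(x)e^{-zx^4}\,dx$, with recurrence coefficients $a_n,b_n$, and let $A_n=A_n(x,z)$, $B_n=B_n(x,z)$ be the rational functions of $x$ defined in the context (a prime denotes $d/dx$). For $n\ge0$ define the second-order differential operator $$\begin{aligned}\mathcal{D}_n=\;&a_nA_nA_{n-1}\frac{d^2}{dx^2}+\left[A_n\,(a_nB_{n-1}-x+b_n)+a_nA_{n-1}(A_n'+B_n)\right]\frac{d}{dx}\\&+\left[a_nB_n'A_{n-1}+B_n\,(a_nB_{n-1}-x+b_n)+1\right].\end{aligned}$$ Then $\mathcal{D}_nP_{n+1}(x)=0$ for all $n\ge0$ (as an identity of rational functions of $x$).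
   Context: The functional $\mathbf{u}_z$ is positive definite. The coefficients $a_n\neq0$ ($n\ge1$) and $b_n$ ($n\ge0$) are defined by $xP_n(x)=P_{n+1}(x)+b_nP_n(x)+a_nP_{n-1}(x)$, $n\ge0$, with $P_{-1}=0$, $P_0=1$. Convention: $a_k=0$ for $k\le0$ and $b_k=0$ for $k<0$. Put $R_n=a_{n+1}+b_n^2+a_n$ and $T_n=a_n(b_n+b_{n-1})$ (so $T_k=0$ for $k\le0$). For $n\ge0$, $A_n(x,z)=x/C_n(x,z)$ and $B_n(x,z)=D_n(x,z)/C_n(x,z)$, where $$\begin{aligned}C_n(x,z)=\;&4z\left[a_{n+1}(T_{n+2}+T_n)+T_{n+1}(R_{n+1}+R_n)\right]\\&+4z\left[a_{n+1}(R_{n+1}+R_{n-1})+T_{n+1}(b_n+b_{n-1})\right](x-b_n)\\&+4z\left[T_{n+1}+a_{n+1}(b_{n-1}+b_{n-2})\right]\left[(x-b_{n-1})(x-b_n)-a_n\right]\\&+4za_{n+1}\Big((x-b_{n-2})\left[(x-b_{n-1})(x-b_n)-a_n\right]-a_{n-1}(x-b_n)\Big),\end{aligned}$$ $$\begin{aligned}D_n(x,z)=\;&-(n+1)+4z\left[a_{n+1}(R_{n+1}+R_{n-1})+T_{n+1}(b_n+b_{n-1})\right]\\&+4z\left[T_{n+1}+a_{n+1}(b_{n-1}+b_{n-2})\right](x-b_{n-1})\\&+4za_{n+1}\left[(x-b_{n-2})(x-b_{n-1})-a_{n-1}\right].\end{aligned}$$ For $n=0$, the terms containing the factor $a_0=0$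 (those involving $A_{-1}$, $B_{-1}$) are taken to be zero. *)

(* Defs.v *)
From HB Require Import structures.
From mathcomp Require Import all_boot all_order all_algebra.
From mathcomp Require Import all_classical all_reals all_analysis.
From mathcomp Require Import ring.

Set Implicit Arguments.
Unset Strict Implicit.
Unset Printing Implicit Defensive.

Import Order.TTheory GRing.Theory Num.Theory.
Import numFieldNormedType.Exports.

Local Open Scope classical_set_scope.
Local Open Scope ring_scope.

(* The field of rational functions R(x), with polynomials and constants
   embedded in it. *)
Definition polyF (R : idomainType) (p : {poly R}) : {fraction {poly R}} :=
  tofrac p.

Definition constF (R : idomainType) (c : R) : {fraction {poly R}} :=
  polyF c%:P.

(* The quotient rule is applied to the representative chosen by the quotient
   type {fraction _}; by fderivE below the choice does not matter. *)
Definition fderiv (R : idomainType) (f : {fraction {poly R}}) :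
    {fraction {poly R}} :=
  let p := (frac (repr f)).1 in
  let q := (frac (repr f)).2 in
  polyF (p^`() * q - p * q^`()) / polyF (q ^+ 2).

Lemma frac_repr (R : idomainType) (f : {fraction {poly R}}) :
  f = polyF (frac (repr f)).1 / polyF (frac (repr f)).2.
Proof.
set r := repr f.
have r0 : polyF (frac r).2 != 0 by rewrite /polyF tofrac_eq0 denom_ratioP.
apply: (canRL (mulfK r0)).
rewrite -[f]reprK -/r /polyF; unlock FracField.tofrac.
rewrite -[LHS]FracField.pi_mul; apply/eqmodP.
rewrite /= /FracField.equivf /FracField.mulf.
rewrite !numden_Ratio ?mulf_neq0 ?oner_neq0 ?denom_ratioP //.
by rewrite !mulr1 mulrC.
Qed.

Lemma fderivE (R : idomainType) (p q : {poly R}) : q != 0 ->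
  fderiv (polyF p / polyF q) =
  polyF (p^`() * q - p * q^`()) / polyF (q ^+ 2).
Proof.
move=> q0; rewrite /fderiv; have := frac_repr (polyF p / polyF q).
set r := repr _; set u := (frac r).1; set v := (frac r).2 => E.
have v0 : v != 0 by exact: denom_ratioP.
have {}E : p * v = u * q.
  move/eqP: E; rewrite eqr_div /polyF ?tofrac_eq0 //.
  by rewrite -!tofracM tofrac_eq => /eqP.
have E' : p^`() * v + p * v^`() = u^`() * q + u * q^`().
  by rewrite -!derivM E.
apply/eqP; rewrite eqr_div /polyF ?tofrac_eq0 ?expf_neq0 //.
rewrite -!tofracM tofrac_eq; apply/eqP.
have -> : (u^`() * v - u * v^`()) * q ^+ 2 =
  v * q * (u^`() * q + u * q^`()) - v * q^`() * (u * q) - (u * q) * q * v^`().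
  ring.
rewrite -E -E'; ring.
Qed.

Section Semiclassical.
Variable R : realType.
Implicit Types (z : R) (P : nat -> {poly R}) (a b : int -> R).

Definition u_functional z (p : {poly R}) : R :=
  \int[lebesgue_measure]_(x in `[0, +oo[) (p.[x] * expR (- z * x ^+ 4)).

Definition monic_orthogonal (u : {poly R} -> R) P : Prop :=
  [/\ forall n, P n \is monic,
      forall n, size (P n) = n.+1,
      forall m n, m != n -> u (P m * P n) = 0
    & forall n, u (P n * P n) != 0].

(* Indices are integers so that b_(n-2), T_(n-1), A_(n-1), ... keep their
   literal meaning for small n. *)
Definition recurrence_coefficients P a b : Prop :=
  [/\ forall k : int, k <= 0 -> a k = 0,
      forall k : int, k < 0 -> b k = 0
    & forall n : nat,
        'X * P n = P n.+1 + b n%:Z *: P n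
                 + a n%:Z *: (if n is m.+1 then P m else 0)].

Definition Rcoef a b (n : int) : R := a (n + 1) + b n ^+ 2 + a n.

Definition Tcoef a b (n : int) : R := a n * (b n + b (n - 1)).

Section LadderCoefficients.
Variables (z : R) (a b : int -> R).
Let r := Rcoef a b.
Let t := Tcoef a b.
Let xb (n : int) : {poly R} := 'X - (b n)%:P.

Definition Cpoly (n : int) : {poly R} :=
    (4 * z * (a (n + 1) * (t (n + 2) + t n)
              + t (n + 1) * (r (n + 1) + r n)))%:P
  + (4 * z * (a (n + 1) * (r (n + 1) + r (n - 1))
              + t (n + 1) * (b n + b (n - 1)))) *: xb n
  + (4 * z * (t (n + 1) + a (n + 1) * (b (n - 1) + b (n - 2)))) *:
      (xb (n - 1) * xb n - (a n)%:P)
  + (4 * z * a (n + 1)) *: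
      (xb (n - 2) * (xb (n - 1) * xb n - (a n)%:P) - a (n - 1) *: xb n).

Definition Dpoly (n : int) : {poly R} :=
    (- (n + 1)%:~R
     + 4 * z * (a (n + 1) * (r (n + 1) + r (n - 1))
                + t (n + 1) * (b n + b (n - 1))))%:P
  + (4 * z * (t (n + 1) + a (n + 1) * (b (n - 1) + b (n - 2)))) *: xb (n - 1)
  + (4 * z * a (n + 1)) *: (xb (n - 2) * xb (n - 1) - (a (n - 1))%:P).

(* For n = -1 the denominator is the zero polynomial (a_0 = T_0 = 0), and
   division by zero returns 0; this agrees with the convention that the terms
   with A_(-1), B_(-1), which carry the factor a_0 = 0, vanish. *)
Definition Afrac (n : int) : {fraction {poly R}} := polyF 'X / polyF (Cpoly n).

Definition Bfrac (n : int) : {fraction {poly R}} :=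
  polyF (Dpoly n) / polyF (Cpoly n).

Definition diff_operator (n : int) (f : {fraction {poly R}}) :
    {fraction {poly R}} :=
  let an := constF (a n) in
  let x_bn := polyF (xb n) in
    an * Afrac n * Afrac (n - 1) * fderiv (fderiv f)
  + (Afrac n * (an * Bfrac (n - 1) - x_bn)
     + an * Afrac (n - 1) * (fderiv (Afrac n) + Bfrac n)) * fderiv f
  + (an * fderiv (Bfrac n) * Afrac (n - 1)
     + Bfrac n * (an * Bfrac (n - 1) - x_bn) + 1) * f.

End LadderCoefficients.
End Semiclassical.

(* Main.v *)
Require Import Defs.
From mathcomp Require Import all_boot all_order all_algebra.
From mathcomp Require Import all_classical all_reals all_analysis.
From mathcomp Require Import measurable_realfun ring zify.

(* Integrating (x P_{n+1} q e^{-zx^4})' over [0, +oo[ shows that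
   x P_{n+1}' - 4z x^4 P_{n+1} is orthogonal to every q of degree at most n.
   Iterating the recurrence writes 4z x^4 P_{n+1} as a part orthogonal to these
   q plus 4z times a combination S of P_n, ..., P_{n-3}, so that
   x P_{n+1}' = (n+1) P_{n+1} + 4z S. Eliminating P_{n-1}, P_{n-2}, P_{n-3} by the
   recurrence turns the right-hand side into C_n P_n - D_n P_{n+1}, that is
   P_n = A_n P_{n+1}' + B_n P_{n+1}; here C_n <> 0 because its leading coefficient
   is 4z a_{n+1}. Substituting this formula for P_n and P_{n-1} into the recurrence
   gives the differential equation. *)

Set Implicit Arguments.
Unset Strict Implicit.
Unset Printing Implicit Defensive.

Import Order.TTheory GRing.Theory Num.Theory.
Import numFieldNormedType.Exports.
Local Open Scope classical_set_scope.
Local Open Scope ring_scope.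

(** * Decay, integrability and integration by parts for the quartic weight *)

Section QuarticWeight.
Variables (R : realType) (z : R).
Hypothesis z_gt0 : 0 < z.

Let mu := @lebesgue_measure R.
Let w (x : R) : R := expR (- z * x ^+ 4).

(** Term by term: x^i <= i! e^x for x >= 0, by the exponential series. *)
Lemma horner_le_expR (p : {poly R}) :
  exists2 K, 0 <= K & forall x : R, 0 <= x -> `|p.[x]| <= K * expR x.
Proof.
exists (\sum_(i < size p) `|p`_i| * i`!%:R).
  by apply: sumr_ge0 => i _; rewrite mulr_ge0.
move=> x x_ge0; rewrite horner_coef mulr_suml.
apply: le_trans (ler_norm_sum _ _ _) _; apply: ler_sum => i _.
rewrite normrM -mulrA ler_wpM2l// ger0_norm ?exprn_ge0//.
case: (nat_of_ord i) => [|k].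
  by rewrite expr0 mul1r (le_trans _ (expR_ge1Dx x))// lerDl.
rewrite mulrC -ler_pdivrMr ?ltr0n ?fact_gt0//.
by rewrite (le_trans _ (expR_ge1Dxn k x_ge0))// lerDr.
Qed.

(** Completing squares in x^2 and then in x bounds the quartic exponent by a linear one. The rate 2
    leaves a factor e^{-x} once e^x has been spent on a polynomial through [horner_le_expR]. *)
Lemma weight_le_expR (x : R) : w x <= expR (z^-1 + 2^-1) * expR (- x) ^+ 2.
Proof.
rewrite -expRM_natl -expRD ler_expR.
have -> : - z * x ^+ 4 =
    z^-1 + 2^-1 + 2%:R * - x - z * (x ^+ 2 - z^-1) ^+ 2 - 2 * (x - 2^-1) ^+ 2.
  by field; exact: lt0r_neq0.
rewrite -addrA -opprD gerBl addr_ge0// mulr_ge0 ?sqr_ge0//; exact: ltW.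
Qed.

Lemma horner_weight_le_expR (p : {poly R}) :
  exists2 K, 0 <= K &
    forall x : R, 0 <= x -> `|p.[x] * w x| <= K * expR (- x).
Proof.
have [K K_ge0 pK] := horner_le_expR p.
exists (K * expR (z^-1 + 2^-1)) => [|x x_ge0]; first by rewrite mulr_ge0 ?expR_ge0.
rewrite normrM [`|w x|]ger0_norm ?expR_ge0//.
have -> : K * expR (z^-1 + 2^-1) * expR (- x) =
    K * expR x * (expR (z^-1 + 2^-1) * expR (- x) ^+ 2).
  by rewrite expRN; field; rewrite lt0r_neq0 ?expR_gt0.
by apply: ler_pM; rewrite ?expR_ge0 ?pK ?weight_le_expR.
Qed.

Lemma continuous_weight : continuous w.
Proof.
move=> x; apply: continuous_comp; last exact: continuous_expR.
by apply: cvgM; [exact: cvg_cst|exact: exprn_continuous].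
Qed.

Lemma continuous_horner_weight (p : {poly R}) :
  continuous (fun x : R => p.[x] * w x).
Proof.
by move=> x; apply: cvgM; [exact: continuous_horner|exact: continuous_weight].
Qed.

Lemma integrable_expRN : mu.-integrable `[0, +oo[ (EFin \o (fun x => expR (- x))).
Proof.
have : mu.-integrable `[0, +oo[ (EFin \o exponential_pdf (1 : R)).
  exact: integrableS (integrable_exponential_pdf ltr01).
apply: eq_integrable => // x; rewrite inE/= in_itv/= andbT => x_ge0.
by rewrite exponential_pdfE// mul1r mulN1r.
Qed.

Lemma integrable_horner_weight (p : {poly R}) :
  mu.-integrable `[0, +oo[ (EFin \o (fun x => p.[x] * w x)).
Proof.
have [K K_ge0 pK] := horner_weight_le_expR p.
apply: (@le_integrable _ _ _ mu _ _ _ (EFin \o (fun x => K * expR (- x)))) => //.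
- apply/measurable_EFinP; apply: measurable_funTS.
  by apply: continuous_measurable_fun; exact: continuous_horner_weight.
- move=> x; rewrite /= in_itv/= andbT => x_ge0.
  rewrite lee_fin (le_trans (pK x x_ge0))// ler_norm//.
- exact: (@integrableZl _ _ _ mu _ _ K _ integrable_expRN).
Qed.

Lemma u_functionalD p q :
  u_functional z (p + q) = u_functional z p + u_functional z q.
Proof.
rewrite /u_functional -RintegralD//; try exact: integrable_horner_weight.
by under eq_Rintegral do rewrite hornerD mulrDl.
Qed.

Lemma u_functionalZ c p : u_functional z (c *: p) = c * u_functional z p.
Proof.
rewrite /u_functional -RintegralZl//; last exact: integrable_horner_weight.
by under eq_Rintegral do rewrite hornerZ -mulrA.
Qed.

Lemma derive_horner_weight (p : {poly R}) (x : R) :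
  is_derive x 1 (fun y => p.[y] * w y)
    ((p^`() - (4 * z) *: ('X^3 * p)).[x] * w x).
Proof.
have dw : is_derive x (1 : R) w (- (4 * z * x ^+ 3) * w x).
  have wE : w = expR \o horner (- z *: 'X^4).
    by apply/funext => y; rewrite /= hornerZ hornerXn.
  have -> : - (4 * z * x ^+ 3) * w x = w x * ((- z *: 'X^4)^`()).[x].
    by rewrite derivZ derivXn /= hornerZ hornerMn hornerXn; ring.
  by rewrite wE; exact: is_derive1_comp.
have -> : (p^`() - (4 * z) *: ('X^3 * p)).[x] * w x =
    p.[x] *: (- (4 * z * x ^+ 3) * w x) + w x *: p^`().[x].
  by rewrite !hornerE /GRing.scale/=; ring.
exact: is_deriveM.
Qed.

Lemma cvg_horner_weight (p : {poly R}) : p.[x] * w x @[x --> +oo] --> 0.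
Proof.
have [K K_ge0 pK] := horner_weight_le_expR p.
have K0 : K * expR (- x) @[x --> +oo] --> 0.
  rewrite -[X in _ --> X](mulr0 K).
  by apply: cvgM; [exact: cvg_cst|exact: cvgr_expR].
apply/norm_cvg0P.
apply: (@squeeze_cvgr _ _ _ _ (cst 0) (fun x => K * expR (- x))) => //;
  last exact: cvg_cst.
by near=> x; rewrite normr_ge0 pK.
Unshelve. all: by end_near. Qed.

(* The derivative F' of F = p e^{-zx^4} changes sign, but F' + M e^{-x} is
   nonnegative for large M, so the fundamental theorem applies to
   F - M e^{-x}. *)
Lemma u_functional_deriv (p : {poly R}) :
  u_functional z (p^`() - (4 * z) *: ('X^3 * p)) = - p.[0].
Proof.
set q := p^`() - _.
have [M M_ge0 qM] := horner_weight_le_expR q.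
have cE : continuous (fun x : R => expR (- x)).
  by move=> x; apply: continuous_comp; [exact: continuousN|exact: continuous_expR].
have dE (x : R) : is_derive x (1 : R) (fun x => M * expR (- x)) (- (M * expR (- x))).
  have NE : (fun y : R => expR (- y)) = expR \o horner (- 'X).
    by apply/funext => y; rewrite /= hornerN hornerX.
  have -> : - (M * expR (- x)) = M *: (expR (- x) * ((- 'X)^`()).[x]).
    by rewrite derivN derivX hornerN hornerC /GRing.scale/=; ring.
  apply: is_deriveZ; rewrite NE; apply: is_derive1_comp.
  by rewrite hornerN hornerX; exact: is_derive_expR.
have FTC (F f : R -> R) (l : R) : (forall x : R, 0 <= x -> 0 <= f x) ->
    continuous f -> F x @[x --> +oo] --> l ->
    (forall x : R, is_derive x (1 : R) F (f x)) ->
    \int[mu]_(x in `[0, +oo[) f x = l - F 0.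
  move=> f_ge0 cf Fl dF.
  apply: Rintegral_ge0_continuous_FTC2y => //.
  - exact: continuous_subspaceT.
  - apply: cvg_at_right_filter; apply: differentiable_continuous.
    by apply/derivable1_diffP.
  - by move=> x _; rewrite derive1E; apply: derive_val.
have cME : M * expR (- x) @[x --> +oo] --> 0.
  rewrite -[X in _ --> X](mulr0 M).
  by apply: cvgM; [exact: cvg_cst|exact: cvgr_expR].
(* The added term integrates to [M], which cancels at the end and leaves [- p.[0]]. *)
have intME : \int[mu]_(x in `[0, +oo[) (M * expR (- x)) = M.
  transitivity (0 - - (M * expR (- 0))).
    apply: (FTC (fun x => - (M * expR (- x)))).
    - by move=> x _; rewrite mulr_ge0 ?expR_ge0.
    - by move=> x; apply: cvgM; [exact: cvg_cst|exact: cE].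
    - by rewrite -oppr0; exact: cvgN.
    - by move=> x; rewrite -[X in is_derive _ _ _ X]opprK; apply: is_deriveN.
  by rewrite oppr0 expR0 mulr1 opprK add0r.
have : \int[mu]_(x in `[0, +oo[) (q.[x] * w x + M * expR (- x)) = M - p.[0].
  transitivity (0 - (p.[0] * w 0 - M * expR (- 0))); last first.
    by rewrite oppr0 expR0 mulr1 /w expr0n mulr0 expR0; ring.
  apply: (FTC (fun x => p.[x] * w x - M * expR (- x))).
  - move=> x x_ge0; rewrite -lerBlDr sub0r.
    by have /ler_normlP[+ _] := qM _ x_ge0; rewrite lerNl.
  - move=> x; apply: cvgD; first exact: continuous_horner_weight.
    by apply: cvgM; [exact: cvg_cst|exact: cE].
  - by rewrite -[X in _ --> X](subr0 0); apply: cvgB; first exact: cvg_horner_weight.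
  - move=> x; rewrite -[M * _]opprK.
    by apply: is_deriveB; exact: derive_horner_weight.
rewrite RintegralD ?intME//.
- by rewrite -/(u_functional z q) => /(canRL (addrK _)) ->; ring.
- exact: integrable_horner_weight.
- exact: (@integrableZl _ _ _ mu _ _ M _ integrable_expRN).
Qed.

End QuarticWeight.

(* Over an abstract field because field is too slow on {fraction _}. *)
Lemma quotient_ruleM (F : fieldType) (p q r s p' q' r' s' : F) :
  q != 0 -> s != 0 ->
  ((p' * r + p * r') * (q * s) - p * r * (q' * s + q * s')) / (q * s) ^+ 2 =
  (p' * q - p * q') / q ^+ 2 * (r / s) + p / q * ((r' * s - r * s') / s ^+ 2).
Proof. by move=> q0 s0; field; rewrite q0 s0. Qed.

Lemma quotient_ruleD (F : fieldType) (p q r s p' q' r' s' : F) :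
  q != 0 -> s != 0 ->
  ((p' * s + p * s' + (r' * q + r * q')) * (q * s)
    - (p * s + r * q) * (q' * s + q * s')) / (q * s) ^+ 2 =
  (p' * q - p * q') / q ^+ 2 + (r' * s - r * s') / s ^+ 2.
Proof. by move=> q0 s0; field; rewrite q0 s0. Qed.

(** * Derivation rules in the field of rational functions *)

Section FractionDerivation.
Variable R : idomainType.
Implicit Types (f g : {fraction {poly R}}).

Lemma fderiv_poly (p : {poly R}) : fderiv (polyF p) = polyF p^`().
Proof.
have := @fderivE R p 1 (oner_neq0 _).
by rewrite expr1n /polyF !tofrac1 !divr1 derivC mulr1 mulr0 subr0.
Qed.

Lemma fderivM f g : fderiv (f * g) = fderiv f * g + f * fderiv g.
Proof.
rewrite (frac_repr f) (frac_repr g).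
have := denom_ratioP (repr g); have := denom_ratioP (repr f).
move: (frac (repr f)) (frac (repr g)) => [p q] [r s] /= q0 s0.
rewrite mulf_div /polyF -!tofracM -/(polyF _) -/(polyF (q * s)).
rewrite !fderivE ?mulf_neq0// !derivM /polyF.
rewrite !(tofracM, tofracD, tofracN, tofracB, tofracXn).
by rewrite quotient_ruleM ?tofrac_eq0.
Qed.

Lemma fderivD f g : fderiv (f + g) = fderiv f + fderiv g.
Proof.
rewrite (frac_repr f) (frac_repr g).
have := denom_ratioP (repr g); have := denom_ratioP (repr f).
move: (frac (repr f)) (frac (repr g)) => [p q] [r s] /= q0 s0.
rewrite addf_div ?tofrac_eq0// /polyF -!(tofracM, tofracD).
rewrite -/(polyF _) -/(polyF (q * s)).
rewrite !fderivE ?mulf_neq0// !(derivM, derivD) /polyF.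
rewrite !(tofracM, tofracD, tofracN, tofracB, tofracXn).
by rewrite quotient_ruleD ?tofrac_eq0.
Qed.

End FractionDerivation.

(** * Orthogonality, the three-term recurrence and its iterate *)

Section Orthogonality.
Variables (R : realType) (u : {poly R} -> R) (P : nat -> {poly R}).
Hypothesis uD : forall p q : {poly R}, u (p + q) = u p + u q.
Hypothesis uZ : forall c (p : {poly R}), u (c *: p) = c * u p.
Hypothesis hP : monic_orthogonal u P.

(** As [size] is degree plus one, the test polynomials are those of degree below [m]. *)
Definition orthogonal_below (m : nat) (p : {poly R}) :=
  forall q : {poly R}, (size q <= m)%N -> u (p * q) = 0.

Lemma orthogonal_belowD m p q :
  orthogonal_below m p -> orthogonal_below m q -> orthogonal_below m (p + q).
Proof. by move=> hp hq r rm; rewrite mulrDl uD hp ?hq ?addr0. Qed.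

Lemma orthogonal_belowZ m c p :
  orthogonal_below m p -> orthogonal_below m (c *: p).
Proof. by move=> hp r rm; rewrite -scalerAl uZ hp ?mulr0. Qed.

Lemma size_sub_leading n (q : {poly R}) : (size q <= n.+1)%N ->
  (size (q - q`_n *: P n)%R <= n)%N.
Proof.
case: hP => Pm Ps _ _ qn; apply/leq_sizeP => i; rewrite leq_eqVlt.
rewrite coefB coefZ => /predU1P[<-|ni].
  by have /monicP := Pm n; rewrite lead_coefE Ps => ->; rewrite mulr1 subrr.
by rewrite !(@nth_default _ 0 _ i) ?Ps ?mulr0 ?subr0 ?(leq_trans qn).
Qed.

(** Induction on [m]: subtracting a multiple of [P m] from the test polynomial lowers its degree,
    and that multiple is orthogonal to [P n]. *)
Lemma orthogonal_below_P m n : (m <= n)%N -> orthogonal_below m (P n).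
Proof.
case: hP => _ _ Po _; elim: m => [|m IH] mn q qm.
  move: qm; rewrite leqn0 size_poly_eq0 => /eqP ->.
  by rewrite mulr0 -(scale0r 0) uZ mul0r.
rewrite -[q](subrK (q`_m *: P m)) mulrDr uD.
rewrite IH ?size_sub_leading// 1?ltnW//.
by rewrite -scalerAr uZ Po ?mulr0 ?addr0// gtn_eqF.
Qed.

(** Pairing with the top [P n] isolates the top coefficient of [p], because [u (P n * P n)] is
    nonzero; the degree then descends. *)
Lemma orthogonal_below_eq0 n (p : {poly R}) :
  (size p <= n)%N -> orthogonal_below n p -> p = 0.
Proof.
case: hP => _ Ps _ Ph; elim: n => [|n IH] pn po.
  by apply/eqP; rewrite -size_poly_eq0 -leqn0.
have c0 : p`_n = 0.
  have := po _ (eq_leq (Ps n)); rewrite -{1}[p](subrK (p`_n *: P n)).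
  rewrite mulrDl uD mulrC (orthogonal_below_P (leqnn n)) ?size_sub_leading//.
  rewrite -scalerAl uZ add0r => /eqP; rewrite mulf_eq0 (negPf (Ph n)) orbF.
  by move/eqP.
apply: IH => [|q qn]; last by apply: po; rewrite leqW.
by rewrite -[p]subr0 -(scale0r (P n)) -c0 size_sub_leading.
Qed.

Variables a b : int -> R.
Hypothesis hab : recurrence_coefficients P a b.

(** Evaluate u(x P_{n+1} P_n) twice: expanding x P_{n+1} gives a_{n+1} u(P_n^2), expanding x P_n
    gives u(P_{n+1}^2), which is nonzero. *)
Lemma recurrence_coef_neq0 (n : nat) : a n.+1 != 0.
Proof.
case: hP hab => Pm Ps Po Ph [_ _ rec]; apply/eqP => an0.
have : u ('X * P n.+1 * P n) = 0.
  rewrite rec an0 scale0r addr0 mulrDl uD -scalerAl uZ.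
  by rewrite !Po ?mulr0 ?addr0// gtn_eqF// ltnW.
rewrite mulrAC rec 2!mulrDl !uD -!scalerAl !uZ.
rewrite (Po n n.+1) ?ltn_eqF// mulr0 addr0.
have -> : u ((if n is m.+1 then P m else 0) * P n.+1) = 0.
  rewrite mulrC (orthogonal_below_P (leqnn n.+1))//.
  by case: (n) => [|m]; rewrite ?size_poly0 ?Ps //; lia.
by rewrite mulr0 addr0 => /eqP; rewrite (negPf (Ph n.+1)).
Qed.

(** Extension by zero, so that polynomials carry the same integer indices as [a] and [b]. *)
Definition Pint (k : int) : {poly R} := if k is Posz m then P m else 0.

Lemma recurrence_int (k : int) : 0 <= k ->
  'X * Pint k = Pint (k + 1) + (b k)%:P * Pint k + (a k)%:P * Pint (k - 1).
Proof.
case: hab => _ _ rec; case: k => // n _.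
rewrite -PoszD addn1 !mul_polyC [LHS]rec /=; congr (_ + _ *: _).
by case: n => [|n]//; rewrite -addn1 PoszD addrK.
Qed.

(* The factor c kills the recurrence below index 0, where it fails. *)
Lemma recurrence_scaled (c : R) (k : int) : (0 <= k) || (c == 0) ->
  c%:P * ('X * Pint k) =
  c%:P * (Pint (k + 1) + (b k)%:P * Pint k + (a k)%:P * Pint (k - 1)).
Proof. by case/orP => [/recurrence_int -> //|/eqP->]; rewrite !mul0r. Qed.

(** Passing from index 0 to -1 brings in the factor a_0 = 0, so the side condition of
    [recurrence_scaled] survives every downward step. *)
Lemma scaled_index_pred (c : R) (k : int) :
  (0 <= k) || (c == 0) -> (0 <= k - 1) || (c * a k == 0).
Proof.
case/orP => [k0|/eqP->]; last by rewrite mul0r eqxx orbT.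
have [->|kn0] := eqVneq k 0.
  by case: hab => a0 _ _; rewrite a0 ?mulr0 ?eqxx ?orbT.
by apply/orP; left; lia.
Qed.

(** Two applications of the recurrence; [Rcoef] and [Tcoef] collect the two-step paths from k to k
    and to k-1. *)
Lemma sqrX_Pint (c : R) (k : int) : (0 <= k) || (c == 0) ->
  c%:P * ('X ^+ 2 * Pint k) =
  c%:P * (Pint (k + 2) + (b (k + 1) + b k)%:P * Pint (k + 1)
          + (Rcoef a b k)%:P * Pint k + (Tcoef a b k)%:P * Pint (k - 1)
          + (a k * a (k - 1))%:P * Pint (k - 2)).
Proof.
move=> kc.
have kc1 : (0 <= k + 1) || (c == 0).
  by case/orP: kc => [k0|->]; rewrite ?orbT// addr_ge0.
have E0 := recurrence_scaled kc; have E1 := recurrence_scaled kc1.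
have := recurrence_scaled (scaled_index_pred kc).
rewrite addrK (_ : k + 1 + 1 = k + 2) in E1; last by ring.
rewrite subrK (_ : k - 1 - 1 = k - 2); last by ring.
move=> Em.
rewrite polyCM in Em; rewrite /Rcoef /Tcoef !expr2 !(polyCD, polyCM).
have -> : c%:P * ('X * 'X * Pint k) = 'X * (c%:P * ('X * Pint k)) by ring.
rewrite E0 !mulrDr.
have -> : 'X * (c%:P * Pint (k + 1)) = c%:P * ('X * Pint (k + 1)) by ring.
have -> : 'X * (c%:P * ((b k)%:P * Pint k)) = (b k)%:P * (c%:P * ('X * Pint k)).
  by ring.
have -> : 'X * (c%:P * ((a k)%:P * Pint (k - 1))) =
  c%:P * (a k)%:P * ('X * Pint (k - 1)) by ring.
by rewrite E0 E1 Em; ring.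
Qed.

End Orthogonality.

(** * The ladder relation between [P n.+1] and [P n] *)

Lemma Cpoly_neq0 (R : realType) (z : R) (a b : int -> R) (k : int) :
  z != 0 -> a (k + 1) != 0 -> Cpoly z a b k != 0.
Proof.
move=> z0 ak0.
suff C3 : (Cpoly z a b k)`_3 = 4 * z * a (k + 1).
  apply: contraNneq (ak0) => C0; move: C3; rewrite C0 coef0.
  by move/esym/eqP; rewrite !mulf_eq0 (negPf z0) (negPf ak0) pnatr_eq0.
rewrite /Cpoly; move: (4 * z * a (k + 1)) => d.
move: (4 * z * (_ + _)) (4 * z * (_ + _)) (4 * z * (_ + _)) => g f e.
(* Expansion in powers of X: only the last summand of [Cpoly] reaches degree 3. *)
have -> : e%:P + f *: ('X - (b k)%:P)
   + g *: (('X - (b (k - 1))%:P) * ('X - (b k)%:P) - (a k)%:P)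
   + d *: (('X - (b (k - 2))%:P)
             * (('X - (b (k - 1))%:P) * ('X - (b k)%:P) - (a k)%:P)
           - a (k - 1) *: ('X - (b k)%:P)) =
   d *: 'X^3
   + (g - d * (b k + b (k - 1) + b (k - 2))) *: 'X^2
   + (f - g * (b k + b (k - 1)) + d * (b (k - 2) * b (k - 1)
        + b (k - 2) * b k + b (k - 1) * b k - a k - a (k - 1))) *: 'X
   + (e - f * b k + g * (b (k - 1) * b k - a k)
      + d * (a k * b (k - 2) + a (k - 1) * b k
             - b (k - 2) * b (k - 1) * b k))%:P.
  by rewrite -!mul_polyC !(polyCD, polyCN, polyCB, polyCM); ring.
by rewrite !coefE /=; ring.
Qed.

Lemma ladder (R : realType) (z : R) (hz : 0 < z)
    (P : nat -> {poly R}) (hP : monic_orthogonal (u_functional z) P)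
    (a b : int -> R) (hab : recurrence_coefficients P a b) (n : nat) :
  'X * (P n.+1)^`() =
  Cpoly z a b n%:Z * P n - Dpoly z a b n%:Z * P n.+1.
Proof.
have uD := u_functionalD hz; have uZ := u_functionalZ hz.
have [_ Ps _ _] := hP.
set k := n%:Z.
(* The products of [a] vanish as soon as the index of [Pint] is negative, which covers n < 3 without
   separate cases. *)
pose y1 : {poly R} := (a k)%:P * Pint P (k - 1).
pose y2 : {poly R} := (a k * a (k - 1))%:P * Pint P (k - 2).
pose y3 : {poly R} := (a k * a (k - 1) * a (k - 2))%:P * Pint P (k - 3).
have Pk : Pint P k = P n by [].
have Pk1 : Pint P (k + 1) = P n.+1 by rewrite -PoszD addn1.
(* [S] is the part of x^4 P_{n+1} along P_n, ..., P_{n-3}, obtained from x^2 (x^2 P_{n+1}). *)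
pose S : {poly R} :=
  (a (k + 1) * (Tcoef a b (k + 2) + Tcoef a b k)
   + Tcoef a b (k + 1) * (Rcoef a b (k + 1) + Rcoef a b k))%:P * P n
  + (a (k + 1) * (Rcoef a b (k + 1) + Rcoef a b (k - 1))
     + Tcoef a b (k + 1) * (b k + b (k - 1)))%:P * y1
  + (Tcoef a b (k + 1) + a (k + 1) * (b (k - 1) + b (k - 2)))%:P * y2
  + (a (k + 1))%:P * y3.
pose H : {poly R} := 'X ^+ 4 * P n.+1 - S.
have HP : orthogonal_below (u_functional z) n.+1 H.
  have := sqrX_Pint hab (c := 1) (k := k + 3) isT.
  have := sqrX_Pint hab (c := 1) (k := k + 2) isT.
  have := sqrX_Pint hab (c := 1) (k := k + 1) isT.
  have := sqrX_Pint hab (c := 1) (k := k) isT.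
  have := sqrX_Pint hab (scaled_index_pred hab (c := 1) (k := k) isT).
  rewrite !mul1r.
  have -> : k - 1 + 2 = k + 1 by ring.
  have -> : k - 1 + 1 = k by ring.
  have -> : k - 1 - 1 = k - 2 by ring.
  have -> : k - 1 - 2 = k - 3 by ring.
  have -> : k + 1 + 2 = k + 3 by ring.
  have -> : k + 1 + 1 = k + 2 by ring.
  have -> : k + 1 - 1 = k by ring.
  have -> : k + 1 - 2 = k - 1 by ring.
  have -> : k + 2 + 2 = k + 4 by ring.
  have -> : k + 2 + 1 = k + 3 by ring.
  have -> : k + 2 - 1 = k + 1 by ring.
  have -> : k + 2 - 2 = k by ring.
  have -> : k + 3 + 2 = k + 5 by ring.
  have -> : k + 3 + 1 = k + 4 by ring.
  have -> : k + 3 - 1 = k + 2 by ring.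
  have -> : k + 3 - 2 = k + 1 by ring.
  rewrite Pk Pk1 => Em E0 E1 E2 E3.
  (* [e1] to [e4] are the coefficients of P_{n+1} to P_{n+4} in x^4 P_{n+1}; that of P_{n+5} is
     1. *)
  pose e4 := b (k + 4) + b (k + 3) + (b (k + 2) + b (k + 1)).
  pose e3 := Rcoef a b (k + 3)
    + (b (k + 2) + b (k + 1)) * (b (k + 3) + b (k + 2)) + Rcoef a b (k + 1).
  pose e2 := Tcoef a b (k + 3) + (b (k + 2) + b (k + 1)) * Rcoef a b (k + 2)
    + Rcoef a b (k + 1) * (b (k + 2) + b (k + 1)) + Tcoef a b (k + 1).
  pose e1 := a (k + 3) * a (k + 2) + (b (k + 2) + b (k + 1)) * Tcoef a b (k + 2)
    + Rcoef a b (k + 1) * Rcoef a b (k + 1) + Tcoef a b (k + 1) * (b (k + 1) + b k)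
    + a (k + 1) * a k.
  have -> : H = Pint P (k + 5) + e4 *: Pint P (k + 4) + e3 *: Pint P (k + 3)
      + e2 *: Pint P (k + 2) + e1 *: P n.+1.
    rewrite /H (_ : 'X^4 * P n.+1 = 'X^2 * ('X^2 * P n.+1)); last by ring.
    rewrite E1.
    transitivity ('X^2 * Pint P (k + 3)
      + (b (k + 2) + b (k + 1))%:P * ('X^2 * Pint P (k + 2))
      + (Rcoef a b (k + 1))%:P * ('X^2 * P n.+1)
      + (Tcoef a b (k + 1))%:P * ('X^2 * P n)
      + (a (k + 1))%:P * ((a k)%:P * ('X^2 * Pint P (k - 1))) - S).
      by rewrite (polyCM (a (k + 1))); ring.
    rewrite E3 E2 E1 E0 Em /S /y1 /y2 /y3 /e1 /e2 /e3 /e4 -!mul_polyC.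
    rewrite /Rcoef /Tcoef (_ : k + 2 - 1 = k + 1); last by ring.
    rewrite (_ : k - 1 - 1 = k - 2); last by ring.
    by rewrite !(polyCD, polyCM); ring.
  have Pge (j : nat) : orthogonal_below (u_functional z) n.+1 (Pint P (k + j.+1)).
    by rewrite -PoszD; apply: (orthogonal_below_P uD uZ hP); rewrite addnS ltnS leq_addr.
  rewrite -Pk1.
  do 4 (apply: orthogonal_belowD => //;
    last by apply: orthogonal_belowZ => //; exact: Pge).
  exact: Pge.
(* [W] has degree at most n and is orthogonal to all such degrees, hence vanishes. *)
pose W : {poly R} := 'X * (P n.+1)^`() - n.+1%:R *: P n.+1 - (4 * z) *: S.
have W0 : W = 0.
  apply: (orthogonal_below_eq0 uD uZ hP (n := n.+1)).
    have Pint0 (j i : nat) : (n < i)%N -> (Pint P (k - j%:Z))`_i = 0.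
      move=> ni; case E: (k - j%:Z) => [m|m]; last by rewrite coef0.
      by rewrite nth_default // Ps; lia.
    apply/leq_sizeP => i ni.
    rewrite /W /S /y1 /y2 /y3 !(coefB, coefZ, coefD, coefCM) !Pint0 //.
    rewrite (@nth_default _ 0 (P n) i) ?Ps //.
    rewrite !mulr0 !addr0 mulr0 subr0.
    rewrite coefXM; case: i ni => [//|i ni]; rewrite coef_deriv /=.
    (* In degree n+1 the coefficient of x P_{n+1}' is n+1 times that of P_{n+1}, so the two
       cancel. *)
    have [->|i_n] := eqVneq i n; first by rewrite mulr_natl subrr.
    by rewrite nth_default ?mul0rn ?mulr0 ?subr0 // Ps; lia.
  have -> : W = ('X * (P n.+1)^`() - (4 * z) *: ('X^4 * P n.+1))
      + (4 * z) *: H + (- n.+1%:R) *: P n.+1.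
    by rewrite /W /H scalerBr scaleNr addrA subrK addrAC.
  apply: orthogonal_belowD => //; last first.
    by apply: orthogonal_belowZ => //; exact: (orthogonal_below_P uD uZ hP).
  apply: orthogonal_belowD => //; last exact: orthogonal_belowZ.
  move=> q qn.
  (* The factor x kills the boundary term at 0, and the leftover (x q)' still has degree at most n,
     so it is orthogonal to P_{n+1}. *)
  have := u_functional_deriv hz ('X * (P n.+1 * q)).
  have -> : ('X * (P n.+1 * q))^`() - (4 * z) *: ('X^3 * ('X * (P n.+1 * q))) =
      ('X * (P n.+1)^`() - (4 * z) *: ('X^4 * P n.+1)) * q
      + P n.+1 * ('X * q)^`().
    by rewrite !derivM derivX -!mul_polyC; ring.
  rewrite uD hornerM hornerX mul0r oppr0.
  rewrite (orthogonal_below_P uD uZ hP (leqnn n.+1)) ?addr0 //.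
  apply/leq_sizeP => i ni; rewrite coef_deriv coefXM /=.
  by rewrite nth_default ?mul0rn // (leq_trans qn).
(* The recurrences at k, k-1 and k-2, solved for their lowest terms, express [y1], [y2], [y3]
   through P_n and P_{n+1}; this yields the nested products in [Cpoly] and [Dpoly]. *)
have D1 : y1 = ('X - (b k)%:P) * P n - P n.+1.
  by have := recurrence_int hab (isT : 0 <= k); rewrite Pk Pk1 -/y1 mulrBl => ->; ring.
have k1 := scaled_index_pred hab (c := 1) (k := k) isT.
have D2 : y2 = ('X - (b (k - 1))%:P) * y1 - (a k)%:P * P n.
  have := recurrence_scaled hab k1; rewrite mul1r subrK Pk.
  rewrite (_ : k - 1 - 1 = k - 2); last by ring.
  rewrite /y2 /y1 polyCM => E.
  transitivity ((a k)%:P * (P n + (b (k - 1))%:P * Pint P (k - 1)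
      + (a (k - 1))%:P * Pint P (k - 2))
    - (a k)%:P * P n - (a k)%:P * (b (k - 1))%:P * Pint P (k - 1)); first by ring.
  by rewrite -E; ring.
have D3 : y3 = ('X - (b (k - 2))%:P) * y2 - (a (k - 1))%:P * y1.
  have := recurrence_scaled hab (scaled_index_pred hab k1); rewrite mul1r.
  rewrite (_ : k - 1 - 1 = k - 2); last by ring.
  rewrite (_ : k - 2 + 1 = k - 1); last by ring.
  rewrite (_ : k - 2 - 1 = k - 3); last by ring.
  rewrite /y3 /y2 /y1 !polyCM => E.
  transitivity ((a k)%:P * (a (k - 1))%:P * (Pint P (k - 1)
      + (b (k - 2))%:P * Pint P (k - 2) + (a (k - 2))%:P * Pint P (k - 3))
    - (a k)%:P * (a (k - 1))%:P * Pint P (k - 1)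
    - (a k)%:P * (a (k - 1))%:P * (b (k - 2))%:P * Pint P (k - 2)); first by ring.
  by rewrite -E; ring.
move/eqP: W0; rewrite /W -addrA -opprD subr_eq0 => /eqP ->.
rewrite /S D3 D2 D1 /Cpoly /Dpoly -!mul_polyC.
have -> : (- (k + 1)%:~R : R) = - n.+1%:R by rewrite -PoszD addn1.
move: (Rcoef a b) (Tcoef a b) => r t.
by rewrite !(polyCD, polyCM, polyCN); ring.
Qed.

(** * Lowering operator and differential equation *)

Lemma lowering (R : realType) (z : R) (hz : 0 < z)
    (P : nat -> {poly R}) (hP : monic_orthogonal (u_functional z) P)
    (a b : int -> R) (hab : recurrence_coefficients P a b) (n : nat) :
  polyF (P n) = Afrac z a b n * fderiv (polyF (P n.+1))
                + Bfrac z a b n * polyF (P n.+1).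
Proof.
have C0 : polyF (Cpoly z a b n) != 0.
  rewrite /polyF tofrac_eq0; apply: Cpoly_neq0; first exact: lt0r_neq0.
  rewrite -PoszD addn1.
  exact: (recurrence_coef_neq0 (u_functionalD hz) (u_functionalZ hz) hP hab).
rewrite fderiv_poly /Afrac /Bfrac mulrAC [X in _ + X]mulrAC -mulrDl.
apply: (canRL (mulfK C0)); rewrite /polyF -!tofracM -tofracD.
by rewrite (ladder hz hP hab) subrK mulrC.
Qed.

(** Here p, q, r stand for P_{n+1}, P_n, P_{n-1}. The relation for r carries the factor [an], so
    that it also holds for n = 0. *)
Lemma substitute_lowering (F : comRingType)
    (an An Am Bn Bm An' Bn' xb p p' p'' q q' r : F) :
  q = An * p' + Bn * p ->
  q' = An' * p' + An * p'' + (Bn' * p + Bn * p') ->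
  an * r = an * (Am * q' + Bm * q) ->
  p = xb * q - an * r ->
  an * An * Am * p'' + (An * (an * Bm - xb) + an * Am * (An' + Bn)) * p'
    + (an * Bn' * Am + Bn * (an * Bm - xb) + 1) * p = 0.
Proof.
move=> Eq Eq' Er Ep.
transitivity (an * (Am * q' + Bm * q) - xb * q + p); first by rewrite Eq' Eq; ring.
by rewrite -Er Ep; ring.
Qed.

Theorem theorem5p5 (R : realType) (z : R) (hz : 0 < z)
    (P : nat -> {poly R}) (hP : monic_orthogonal (u_functional z) P)
    (a b : int -> R) (hab : recurrence_coefficients P a b) (n : nat) :
  diff_operator z a b n%:Z (polyF (P n.+1)) = 0.
Proof.
pose r : {poly R} := if n is m.+1 then P m else 0.
have low := lowering hz hP hab.
have Er : constF (a n) * polyF r =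
    constF (a n) * (Afrac z a b (n%:Z - 1) * fderiv (polyF (P n))
                    + Bfrac z a b (n%:Z - 1) * polyF (P n)).
  (* For n = 0 both sides vanish through a_0 = 0; otherwise this is [lowering] one index down. *)
  rewrite /r; case: (n) => [|m].
    by case: hab => -> // _ _; rewrite /constF /polyF polyC0 tofrac0 !mul0r.
  by rewrite (_ : m.+1%:Z - 1 = m) ?(low m) //; lia.
have Ep : polyF (P n.+1) =
    polyF ('X - (b n)%:P) * polyF (P n) - constF (a n) * polyF r.
  case: hab => _ _ rec.
  rewrite /constF /polyF -!tofracM -tofracB mulrBl rec !mul_polyC; congr tofrac.
  by rewrite addrAC addrK addrAC subrK.
apply: (substitute_lowering (low n) _ Er Ep).
by rewrite low fderivD !fderivM.
Qed.
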